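(* Let $N\ge2$ be an even integer. (i) Let the offsets $o_0,\dots,o_{N-1}$ be i.i.d. real $\mathcal{N}(0,\sigma_{\mathbf{o}}^2)$ with $\sigma_{\mathbf{o}}>0$, and let $P^{\mathrm{o}}_k=2|\tilde o_k|^2$ for $k\in\{0,N/2\}$ and $P^{\mathrm{o}}_k=4|\tilde o_k|^2$ for $0<k<N/2$. Then for all $p\ge0$, $$\Pr\left(\max_{0\le k\le N/2}P^{\mathrm{o}}_k\le p\right)=\operatorname{erf}\left(\sqrt{\frac{Np}{4\sigma_{\mathbf{o}}^2}}\right)^{2}\left(1-e^{-\frac{Np}{4\sigma_{\mathbf{o}}^2}}\right)^{N/2-1}.$$ (ii) Let the gain mismatches $g_0,\dots,g_{N-1}$ be i.i.d. real $\mathcal{N}(0,\sigma_{\mathbf{g}}^2)$ with $\sigma_{\mathbf{g}}>0$, and let $P^{\mathrm{g}}_k=|\tilde g_k|^2$. Then for all $p\ge0$, $$\Pr\left(\max_{1\le k\le N-1}P^{\mathrm{g}}_k\le p\right)=\operatorname{erf}\left(\sqrt{\frac{Np}{2\sigma_{\mathbf{g}}^2}}\right)\left(1-e^{-\frac{Np}{\sigma_{\mathbf{g}}^2}}\right)^{N/2-1}.$$ (iii) Let $f_{\mathrm{sig}}>0$, let the timing skews $s_0,\dots,s_{N-1}$ be i.i.d. real $\mathcal{N}(0,\sigma_{\mathbf{s}}^2)$ with $\sigma_{\mathbf{s}}>0$, and let $P^{\mathrm{s}}_k=(2\pi f_{\mathrm{sig}})^2|\tilde s_k|^2$. Then for all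 $p\ge0$, $$\Pr\left(\max_{1\le k\le N-1}P^{\mathrm{s}}_k\le p\right)=\operatorname{erf}\left(\sqrt{\frac{Np}{8\pi^2f_{\mathrm{sig}}^2\sigma_{\mathbf{s}}^2}}\right)\left(1-e^{-\frac{Np}{4\pi^2f_{\mathrm{sig}}^2\sigma_{\mathbf{s}}^2}}\right)^{N/2-1}.$$
   Context: For $\mathbf{u}\in\mathbb{C}^N$ with entries $u_0,\dots,u_{N-1}$, the normalized DFT is $\tilde u_k=\frac1N\sum_{n=0}^{N-1}e^{-2\pi j kn/N}u_n$, $k=0,\dots,N-1$, with $j$ the imaginary unit. $P^{\mathrm{o}}_k$ is the single-sided power of the offset spur at $kf_s/N$ relative to a full-scale sine wave (amplitude $1$, power $1/2$); $P^{\mathrm{g}}_k$ is the power of the $k$-th gain-mismatch replica relative to the input; $P^{\mathrm{s}}_k$ is the first-order power of the $k$-th skew replica relative to a single-tone input at $f_{\mathrm{sig}}$. For gain and skew, the bin $k=0$ (average mismatch) is disregarded. $\mathcal{N}(0,\sigma^2)$ is the zero-mean real Gaussian distribution of variance $\sigma^2$, and $\operatorname{erf}(x)=\frac{2}{\sqrt\pi}\int_0^x e^{-u^2}du$. A zeroth power equals $1$ (relevant when $N=2$). *)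

(* Defs.v *)
From HB Require Import structures.
From mathcomp Require Export all_boot all_order all_algebra.
From mathcomp Require Export all_classical all_reals all_analysis.
From mathcomp Require Export complex.

Set Implicit Arguments.
Unset Strict Implicit.
Unset Printing Implicit Defensive.

Export Order.TTheory GRing.Theory Num.Theory.
Export numFieldNormedType.Exports.

Local Open Scope classical_set_scope.
Local Open Scope complex_scope.
Local Open Scope ring_scope.

(* The oriented integral, so that erf is the odd function also for x < 0;
   [gauss_fun u] is [expR (- u ^+ 2)]. *)
Definition erf (R : realType) (x : R) : R :=
  2 / Num.sqrt pi *
  (if 0 <= x then \int[lebesgue_measure]_(u in `[0, x]) gauss_fun u
   else - \int[lebesgue_measure]_(u in `[x, 0]) gauss_fun u).

(* The complex exponential of the purely imaginary number j t. *)
Definition cis (R : realType) (t : R) : R[i] := cos t +i* sin t.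

Definition dft (R : realType) (N : nat) (u : 'cV[R[i]]_N) (k : 'I_N) : R[i] :=
  N%:R^-1 * \sum_(n < N) cis (- (2 * pi * k%:R * n%:R / N%:R)) * u n 0.

Definition realvec (R : realType) (N : nat) (x : 'I_N -> R) : 'cV[R[i]]_N :=
  \col_n (x n)%:C.

(* [ComplexField.Normc.normc z] is the modulus of z as an element of R.  The
   three powers below are nonnegative, so the maximum of a nonempty family of
   them is its [\big[Num.max/0]]. *)

(* Meaningful for k <= N/2 only (single-sided spectrum). *)
Definition offset_power (R : realType) (N : nat) (o : 'I_N -> R) (k : 'I_N) : R :=
  (if (k == 0 :> nat)%N || (k == N./2 :> nat)%N then 2 else 4) *
  ComplexField.Normc.normc (dft (realvec o) k) ^+ 2.

Definition gain_power (R : realType) (N : nat) (g : 'I_N -> R) (k : 'I_N) : R :=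
  ComplexField.Normc.normc (dft (realvec g) k) ^+ 2.

Definition skew_power (R : realType) (N : nat) (fsig : R) (s : 'I_N -> R)
    (k : 'I_N) : R :=
  (2 * pi * fsig) ^+ 2 * ComplexField.Normc.normc (dft (realvec s) k) ^+ 2.

Definition mutually_independent (d : measure_display) (T : measurableType d)
    (R : realType) (P : probability T R) (I : finType)
    (X : I -> {RV P >-> R}) : Prop :=
  forall (J : {set I}) (B : I -> set R), (forall i, measurable (B i)) ->
    P (\bigcap_(i in [set` J]) X i @^-1` B i) =
    (\prod_(i in J) P (X i @^-1` B i))%E.

(* The laws are compared on measurable sets only, since the library's measures
   take unspecified values on the other sets.  The parameters of [normal_prob]
   are the mean and the standard deviation. *)
Definition iid_centered_normal (d : measure_display) (T : measurableType d)
    (R : realType) (P : probability T R) (N : nat) (sigma : R)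
    (X : 'I_N -> {RV P >-> R}) : Prop :=
  mutually_independent X /\
  forall (i : 'I_N) (A : set R), measurable A ->
    distribution P (X i) A = normal_prob 0 sigma A.

(* Main.v *)
Require Import Defs.
From HB Require Import structures.
From mathcomp Require Import measurable_realfun ring lra zify.

Local Open Scope classical_set_scope.
Local Open Scope ring_scope.

(* The Hartley coordinates [H_k = N^(-1/2) \sum_n (cos + sin)(2 pi k n / N) x_n]
   form an orthogonal transform of [x], with no case distinction on [k], and
   [|dft_k|^2 = (H_k^2 + H_(-k)^2) / (2 N)] with indices modulo [N].  A sequence
   of i.i.d. centered normals stays i.i.d. under an orthogonal matrix: Givens
   elimination reduces this to rotations of two coordinates, and a plane
   rotation preserves the Gaussian density and, as a product of three shears,
   the Lebesgue measure.  Hence the bins 0 and N/2 and the pairs {k, N - k} are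
   independent, and the substitution [y = |x| v] gives the Gaussian mass
   [1 - exp (- t / (2 sigma^2))] of the disk [x^2 + y^2 <= t]. *)

Set Implicit Arguments.
Unset Strict Implicit.
Unset Printing Implicit Defensive.

(** The real and imaginary parts of the DFT are awkward coordinates: the sine sums vanish in the
    bins 0 and N/2, and in the other bins the cosine and sine sums have half the variance of the
    cosine sums in those two. The Hartley coordinates all have the same variance, so one orthogonal
    matrix serves every bin. Independence is given only as a product formula on boxes of
    one-dimensional measurable sets, whereas the events of interest are disks in pairs of
    coordinates, and a rotation already turns a box into something else. The invariant carried along
    is therefore the product formula on boxes; uniqueness of product measures upgrades chosen pairs
    of coordinates from rectangles to arbitrary measurable sets of the plane. Since a Givens
    rotation mixes two coordinates only, no density or change of variables beyond dimension two
    occurs. *)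

Local Notation pushforward_measure :=
  measure_function_pushforward__canonical__measure_function_Measure (only parsing).

(** * Families of independent variables with a common law *)

Lemma measurable_preimageT d d' (T : measurableType d) (S : measurableType d')
    (f : T -> S) (D : set S) :
  measurable_fun setT f -> measurable D -> measurable (f @^-1` D).
Proof. by move=> mf mD; rewrite -[X in measurable X]setTI; exact: mf. Qed.

(** One set is imposed on every index; a constraint on a subfamily is recovered by taking [setT]
    elsewhere. *)
Definition joint_law (R : realType) (d d' : measure_display)
    (T : measurableType d) (S : measurableType d')
    (P : probability T R) (gam : probability S R) (I : finType)
    (X : I -> T -> S) : Prop :=
  (forall i, measurable_fun setT (X i)) /\
  forall B : I -> set S, (forall i, measurable (B i)) ->
    P [set w | forall i, B i (X i w)] = (\prod_i gam (B i))%E.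

Section product_law.
Context (R : realType) (d d' : measure_display).
Context (T : measurableType d) (S : measurableType d').
Context (P : probability T R) (gam : probability S R).

(** Both sides are measures in [C] that agree on rectangles, which determines them. Scaling by [P A]
    instead of conditioning on [A] also covers [P A = 0]. *)
Lemma product_law_ext (A : set T) (U V : T -> S) :
  measurable A -> measurable_fun setT U -> measurable_fun setT V ->
  (forall B1 B2, measurable B1 -> measurable B2 ->
    P (A `&` [set w | B1 (U w) /\ B2 (V w)]) = (P A * (gam B1 * gam B2))%E) ->
  forall C : set (S * S), measurable C ->
    P (A `&` [set w | C (U w, V w)]) = (P A * (gam \x gam)%E C)%E.
Proof.
move=> mA mU mV AUV C mC.
have mUV : measurable_fun setT (fun w => (U w, V w)) by exact: measurable_fun_pair.
have PA0 : 0 <= fine (P A) by exact: fine_ge0.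
pose r : {nonneg R} := NngNum PA0.
have rE : P A = (r%:num)%:E by rewrite fineK// fin_num_measure.
pose m1 : {finite_measure set S -> \bar R} := mscale r gam.
pose m' : {measure set (S * S) -> \bar R} :=
  pushforward_measure (mrestr P mA) mUV.
have -> : P (A `&` [set w | C (U w, V w)]) = m' C.
  by rewrite /= /pushforward /mrestr setIC.
rewrite -(@product_measure_unique _ _ _ _ _ m1 gam m')//.
  rewrite /product_measure1 /m1/= ge0_integral_mscale//= ?rE//.
  exact: measurable_fun_xsection.
move=> B1 B2 mB1 mB2; rewrite /= /pushforward /mrestr /mscale -muleA -rE -AUV//.
by rewrite setIC.
Qed.

Lemma measurable_forall (I : finType) (Q : pred I) (E : I -> set T) :
  (forall i, Q i -> measurable (E i)) -> measurable [set w | forall i, Q i -> E i w].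
Proof.
move=> mE; rewrite (_ : [set w | _] = \bigcap_(i in [set` Q]) E i).
  by apply: fin_bigcap_measurable => //; exact: finite_finset.
by [].
Qed.

Lemma measurable_forall_seq (I : eqType) (s : seq I) (E : I -> set T) :
  (forall i, measurable (E i)) -> measurable [set w | forall i, i \in s -> E i w].
Proof.
move=> mE; rewrite (_ : [set w | _] = \bigcap_(i in [set` s]) E i).
  by apply: fin_bigcap_measurable => //; exact: finite_seq.
by [].
Qed.

Lemma measurable_preimage_pair (U V : T -> S) (C : set (S * S)) :
  measurable_fun setT U -> measurable_fun setT V -> measurable C ->
  measurable [set w | C (U w, V w)].
Proof.
move=> mU mV mC; exact: (measurable_preimageT (measurable_fun_pair mU mV)).
Qed.

(** By induction on [s]: each step frees one more pair of coordinates from its rectangle, the event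
    [A] collecting the constraints on all other coordinates. The sets [B] stay universally
    quantified because the step changes them at the new pair. *)
Lemma joint_law_pairs (I : finType) (X : I -> T -> S) :
  joint_law P gam X ->
  forall (s : seq (I * I)) (C : I * I -> set (S * S)) (B : I -> set S),
  uniq (unzip1 s ++ unzip2 s) ->
  (forall q, measurable (C q)) -> (forall i, measurable (B i)) ->
  P [set w | (forall q, q \in s -> C q (X q.1 w, X q.2 w)) /\
             (forall i, i \notin unzip1 s ++ unzip2 s -> B i (X i w))] =
  ((\prod_(q <- s) (gam \x gam) (C q)) *
   \prod_(i | i \notin unzip1 s ++ unzip2 s) gam (B i))%E.
Proof.
move=> [mX jX] s C + + mC; elim: s => [|[a b] s IH] B us mB /=.
  rewrite big_nil mul1e (eq_bigl xpredT)// -jX//; congr (P _).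
  by apply/seteqP; split => w /=; [case=> _ h i; exact: h|move=> h; split].
set J := a :: _; set J' := unzip1 s ++ unzip2 s in IH.
have pJ : perm_eq J (a :: b :: J').
  by rewrite /J perm_cons -cat1s perm_catCA.
have {us} : uniq (a :: b :: J') by rewrite -(perm_uniq pJ).
rewrite /= inE negb_or -andbA => /and4P[ab aJ bJ us].
have mJ i : (i \in J) = (i \in a :: b :: J') by rewrite (perm_mem pJ).
pose A := [set w | (forall q, q \in s -> C q (X q.1 w, X q.2 w)) /\
             (forall i, i \notin J -> B i (X i w))].
have mA : measurable A.
  apply: measurableI.
    by apply: measurable_forall_seq => q; exact: measurable_preimage_pair.
  by apply: measurable_forall => i _; exact: (measurable_preimageT (mX i)).
pose pr := ((\prod_(q <- s) (gam \x gam) (C q)) *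
   \prod_(i | i \notin J) gam (B i))%E.
have key B1 B2 : measurable B1 -> measurable B2 ->
    P (A `&` [set w | B1 (X a w) /\ B2 (X b w)]) = (pr * (gam B1 * gam B2))%E.
  move=> mB1 mB2.
  (* A rectangle at [(a, b)] is still a constraint by single coordinates, so the induction
     hypothesis applies with [B1] and [B2] inserted there. *)
  pose B' i := if i == a then B1 else if i == b then B2 else B i.
  have mB' i : measurable (B' i) by rewrite /B'; case: ifP => // _; case: ifP.
  have := IH B' us mB'.
  have aE : B' a = B1 by rewrite /B' eqxx.
  have bE : B' b = B2 by rewrite /B' eqxx eq_sym (negbTE ab).
  rewrite (bigD1 a)//= (bigD1 b) ?bJ 1?eq_sym//= aE bE.
  rewrite (eq_bigl (fun i => i \notin J)); last first.
    by move=> i; rewrite mJ !inE; case: (i == a) (i == b) (i \in J') => [] [] [].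
  rewrite (eq_bigr (fun i => gam (B i))); last first.
    move=> i; rewrite mJ !inE !negb_or => /and3P[ia ib _].
    by rewrite /B' (negbTE ia) (negbTE ib).
  rewrite /pr (muleA (gam B1)) [((gam B1 * gam B2) * _)%E]muleC muleA => <-.
  congr (P _).
  apply/seteqP; split => w /=.
    move=> [[h1 h2] [h3 h4]]; split => // i iJ; rewrite /B'.
    case: eqP => [->//|/eqP ia]; case: eqP => [->//|/eqP ib].
    by apply: h2; rewrite mJ !inE !negb_or ia ib.
  move=> [h1 h2]; split; [split=> // i|].
    rewrite mJ !inE !negb_or => /and3P[ia ib iJ].
    by have := h2 i iJ; rewrite /B' (negbTE ia) (negbTE ib).
  split; first by have := h2 a aJ; rewrite /B' eqxx.
  by have := h2 b bJ; rewrite /B' eqxx eq_sym (negbTE ab).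
have PA : P A = pr.
  have := key setT setT measurableT measurableT.
  rewrite !probability_setT !mule1 => <-; congr (P _).
  by apply/seteqP; split => w //= -[].
have h := product_law_ext mA (mX a) (mX b); rewrite PA in h.
rewrite big_cons -muleA -/pr muleC -(h key)//.
congr (P _); apply/seteqP; split => w /=.
  move=> [h1 h2]; split; [split=> // q qs|]; first by apply: h1; rewrite inE qs orbT.
  by apply: (h1 (a, b)); rewrite inE eqxx.
by move=> [[h1 h2] h3]; split=> // q; rewrite inE => /predU1P[->//|]; exact: h1.
Qed.

End product_law.

(** * Invariance of the Lebesgue measure *)

Section lebesgue_plane.
Context (R : realType).
Notation bR := (measurableTypeR R).
Notation mu := (@lebesgue_measure R).

Lemma lebesgue_measure_translate (a : R) (A : set R) : measurable A ->
  mu ((fun x => x + a) @^-1` A) = mu A.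
Proof.
move=> mA.
have mf : measurable_fun setT (fun x : bR => x + a : bR).
  by apply: measurable_funD => //; exact: measurable_cst.
apply/esym/(@lebesgue_measure_unique _ (pushforward_measure mu mf)) => //.
move=> _ [[x y]] _ <- /=; rewrite /pushforward.
rewrite (_ : _ @^-1` _ = `]x - a, y - a]%classic); last first.
  by apply/seteqP; split => z /=; rewrite !in_itv/= ltrBlDr lerBrDr.
rewrite !lebesgue_measure_itv/= !lte_fin ltrD2r; case: ifP => // _.
by rewrite -EFinB -EFinD; congr (_%:E); rewrite opprB addrA subrK.
Qed.

Lemma measurable_mulrr (c : R) :
  measurable_fun setT (fun x : bR => c * x : bR).
Proof. by apply: measurable_funM => //; exact: measurable_cst. Qed.

Lemma lebesgue_measure_dilate (c : R) (A : set R) : 0 < c -> measurable A ->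
  (c%:E * mu ((fun x => c * x)%R @^-1` A))%E = mu A.
Proof.
move=> c0 mA; pose r : {nonneg R} := NngNum (ltW c0).
apply/esym/(@lebesgue_measure_unique _ (mscale r
  (pushforward_measure mu (measurable_mulrr c)))) => //.
move=> _ [[x y]] _ <- /=; rewrite /mscale/= /pushforward.
rewrite (_ : _ @^-1` _ = `]x / c, y / c]%classic); last first.
  by apply/seteqP; split => z /=; rewrite !in_itv/= ltr_pdivrMr// ler_pdivlMr// mulrC.
rewrite !lebesgue_measure_itv/= !lte_fin ltr_pM2r ?invr_gt0//.
case: ifP => // _; last by rewrite mule0.
by rewrite -!EFinB -EFinM -mulrBl mulrCA divff ?mulr1// gt_eqF.
Qed.

Lemma ge0_integral_dilate (c : R) (D : set R) (f : R -> \bar R) :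
  0 < c -> measurable D -> measurable_fun D f -> (forall x, 0 <= f x)%E ->
  (\int[mu]_(x in D) f x =
   c%:E * \int[mu]_(x in (fun x => c * x)%R @^-1` D) f (c * x)%R)%E.
Proof.
move=> c0 mD mf f0; pose r : {nonneg R} := NngNum (ltW c0).
pose m1 := pushforward_measure mu (measurable_mulrr c).
transitivity (\int[mscale r m1]_(x in D) f x)%E.
  apply: eq_measure_integral => A mA _.
  exact/esym/lebesgue_measure_dilate.
rewrite ge0_integral_mscale//= ge0_integral_pushforward//.
exact: measurable_mulrr.
Qed.

Lemma ge0_integral_opp (D : set R) (f : R -> \bar R) :
  measurable D -> measurable_fun D f -> (forall x, 0 <= f x)%E ->
  (\int[mu]_(x in D) f x = \int[mu]_(x in -%R @^-1` D) f (- x)%R)%E.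
Proof.
move=> mD mf f0.
have mN : measurable_fun setT (-%R : bR -> bR) by [].
transitivity (\int[pushforward_measure mu mN]_(x in D) f x)%E.
  by apply: eq_measure_integral => A mA _; apply/esym/lebesgue_measureN.
by rewrite ge0_integral_pushforward.
Qed.

Notation mu2 := (mu \x mu)%E.

Definition plane_swap (z : bR * bR) : bR * bR := (z.2, z.1).
Definition plane_shear1 (a : bR) (z : bR * bR) : bR * bR := (z.1 + a * z.2, z.2).
Definition plane_shear2 (a : bR) (z : bR * bR) : bR * bR := (z.1, z.2 + a * z.1).

Lemma measurable_plane_swap : measurable_fun setT plane_swap.
Proof. exact: measurable_fun_pair. Qed.

Lemma measurable_plane_shear1 a : measurable_fun setT (plane_shear1 a).
Proof.
apply: measurable_fun_pair => //; apply: measurable_funD => //.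
by apply: measurable_funM => //; exact: measurable_cst.
Qed.

Lemma measurable_plane_shear2 a : measurable_fun setT (plane_shear2 a).
Proof.
apply: measurable_fun_pair => //; apply: measurable_funD => //.
by apply: measurable_funM => //; exact: measurable_cst.
Qed.

Lemma lebesgue_plane_swap (C : set (bR * bR)) : measurable C ->
  mu2 (plane_swap @^-1` C) = mu2 C.
Proof.
move=> mC.
pose m' := pushforward_measure mu2 measurable_plane_swap.
apply/esym/(@product_measure_unique _ _ _ _ _ mu mu m') => // A B mA mB.
rewrite /= /pushforward (_ : _ @^-1` _ = B `*` A); last first.
  by apply/seteqP; split => -[x y] /= [].
by rewrite product_measure1E// muleC.
Qed.

(** The product measure integrates the measures of the sections over [x], and the shear translates
    the section at [x] by [a * x]. *)
Lemma lebesgue_plane_shear2 a (C : set (bR * bR)) : measurable C ->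
  mu2 (plane_shear2 a @^-1` C) = mu2 C.
Proof.
move=> mC; apply: eq_integral => x _ /=.
rewrite -(@lebesgue_measure_translate (a * x) (xsection C x)).
  by congr (mu _); apply/seteqP; split => y; rewrite /xsection /plane_shear2 /= !inE.
exact: measurable_xsection.
Qed.

Lemma lebesgue_plane_shear1 a (C : set (bR * bR)) : measurable C ->
  mu2 (plane_shear1 a @^-1` C) = mu2 C.
Proof.
move=> mC; have mp := @measurable_preimageT _ _ (bR * bR)%type (bR * bR)%type.
have mswC : measurable (plane_swap @^-1` C).
  (* The horizontal shear is the vertical one conjugated by the swap of coordinates. *)
  exact: (mp plane_swap _ measurable_plane_swap).
rewrite -[RHS]lebesgue_plane_swap// -[RHS](@lebesgue_plane_shear2 a)//.
rewrite -[RHS]lebesgue_plane_swap//.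
exact: (mp (plane_shear2 a) _ (@measurable_plane_shear2 a)).
Qed.

Definition planerot (c s : R) (z : bR * bR) : bR * bR :=
  (c * z.1 - s * z.2, s * z.1 + c * z.2).

Lemma measurable_planerot c s : measurable_fun setT (planerot c s).
Proof.
apply: measurable_fun_pair; [apply: measurable_funB|apply: measurable_funD];
 by apply: measurable_funM => //; exact: measurable_cst.
Qed.

Lemma lebesgue_plane_rot c s (C : set (bR * bR)) : measurable C ->
  s != 0 -> c ^+ 2 + s ^+ 2 = 1 -> mu2 (planerot c s @^-1` C) = mu2 C.
Proof.
move=> mC s0 cs.
have mp := @measurable_preimageT _ _ (bR * bR)%type (bR * bR)%type.
(* For [c] and [s] the cosine and sine of an angle, [a] is minus the tangent of the half angle, and
   the rotation is shear [a], then shear [s] in the other direction, then shear [a]. This is where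
   [s != 0] enters. *)
pose a := (c - 1) / s.
have -> : planerot c s = plane_shear1 a \o (plane_shear2 s \o plane_shear1 a).
  apply/funext => -[x y]; rewrite /= /planerot /plane_shear1 /plane_shear2 /=.
  have as_ : a * s = c - 1 by rewrite divfK.
  have ac : a * (1 + c) = - s.
    apply: (mulIf s0); rewrite mulrAC as_ mulNr -expr2.
    have -> : s ^+ 2 = 1 - c ^+ 2 by rewrite -cs addrC addKr.
    ring.
  have cE : c = 1 + a * s by rewrite as_; ring.
  congr (_, _); last by rewrite {1}cE; ring.
  rewrite -mulNr -ac {1 2}cE; ring.
have m1 := mp (plane_shear1 a) C (@measurable_plane_shear1 a) mC.
have m2 := mp (plane_shear2 s) _ (@measurable_plane_shear2 s) m1.
rewrite 2!comp_preimage lebesgue_plane_shear1// lebesgue_plane_shear2//.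
exact: lebesgue_plane_shear1.
Qed.

End lebesgue_plane.

(** * The Gaussian measure of the plane *)

(** The proofs [mf] and [f0] are arguments so that the measure structure declared below can be
    inferred from the term alone. *)
Definition density_measure d (T : measurableType d) (R : realType)
    (mu : set T -> \bar R) (f : T -> R)
    (mf : measurable_fun setT f) (f0 : forall x, 0 <= f x) : set T -> \bar R :=
  fun A => (\int[mu]_(x in A) (f x)%:E)%E.

Section density_measure.
Context d (T : measurableType d) (R : realType) (mu : {measure set T -> \bar R}).
Context (f : T -> R) (mf : measurable_fun setT f) (f0 : forall x, 0 <= f x).
Local Notation nu := (density_measure mu mf f0).

Let nu0 : nu set0 = 0%E. Proof. exact: integral_set0. Qed.

Let nu_ge0 A : (0 <= nu A)%E.
Proof. by apply: integral_ge0 => x _; rewrite lee_fin. Qed.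

Let nu_sigma_additive : semi_sigma_additive nu.
Proof.
move=> F mF tF mUF; rewrite /density_measure ge0_integral_bigcup//=.
- by apply: is_cvg_ereal_nneg_natsum_cond => n _ _; exact: nu_ge0.
- by apply/measurable_EFinP; exact: measurable_funTS.
- by move=> x _; rewrite lee_fin.
Qed.

HB.instance Definition _ := isMeasure.Build _ _ _ nu nu0 nu_ge0 nu_sigma_additive.
End density_measure.

Section gauss_plane.
Context (R : realType) (sigma : R).
Context (sigma_gt0 : 0 < sigma).
Notation bR := (measurableTypeR R).
Notation mu := (@lebesgue_measure R).
Notation mu2 := (mu \x mu)%E.
Notation gam := (normal_prob 0 sigma).
Notation g := (normal_pdf 0 sigma).

Let g_ge0 x : 0 <= g x. Proof. exact: normal_pdf_ge0. Qed.
Let mg : measurable_fun setT (g : bR -> R). Proof. exact: measurable_normal_pdf. Qed.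

Let g2 (z : bR * bR) : R := g z.1 * g z.2.
Let mg2 : measurable_fun setT g2.
Proof. by apply: measurable_funM; exact: measurableT_comp. Qed.
Let g2_ge0 z : 0 <= g2 z. Proof. exact: mulr_ge0. Qed.

Lemma normal_pdf0E x :
  g x = (Num.sqrt (2 * sigma ^+ 2 * pi))^-1 * expR (- x ^+ 2 / (2 * sigma ^+ 2)).
Proof.
rewrite normal_pdfE ?gt_eqF// /normal_peak /normal_fun subr0.
by rewrite -(mulr_natl (sigma ^+ 2)) -(mulr_natl (sigma ^+ 2 * pi)) mulrA.
Qed.

(** The product depends on the radius only; both the rotation invariance and the mass of disks rest
    on this. *)
Lemma normal_pdf0M x y :
  g x * g y = (2 * sigma ^+ 2 * pi)^-1 * expR (- (x ^+ 2 + y ^+ 2) / (2 * sigma ^+ 2)).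
Proof.
rewrite !normal_pdf0E mulrACA -expRD -invfM -expr2 sqr_sqrtr.
  by rewrite -mulrDl -opprD.
by rewrite !mulr_ge0 ?pi_ge0 ?sqr_ge0 ?ler0n ?(ltW sigma_gt0).
Qed.

(** By uniqueness of the product measure it suffices to compare on rectangles, where Tonelli splits
    the integral into two factors. *)
Lemma normal_prod_density (C : set (bR * bR)) : measurable C ->
  (gam \x gam)%E C = (\int[mu2]_(z in C) (g z.1 * g z.2)%:E)%E.
Proof.
move=> mC.
rewrite (@product_measure_unique _ _ _ _ _ (normal_prob 0 sigma)
  (normal_prob 0 sigma) (density_measure mu2 mg2 g2_ge0))//.
move=> A B mA mB; rewrite /= /density_measure integral_mkcond.
have gE D (f : bR -> R) : (fun x => (f x)%:E) \_ D = (fun x => (f x * \1_D x)%:E).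
  apply/funext => x; rewrite /patch indicE; case: ifPn; rewrite ?mulr1 ?mulr0//.
have mgD (D : set bR) : measurable D ->
    measurable_fun setT (fun x : bR => (g x * \1_D x)).
  by move=> mD; apply: measurable_funM => //; exact: measurable_indic.
rewrite [X in (\int[_]_x X x)%E](_ : _ =
    (fun z => ((g z.1 * \1_A z.1) * (g z.2 * \1_B z.2))%:E)).
  rewrite fubini_tonelli1/=; last 2 first.
  - apply/measurable_EFinP; apply: measurable_funM.
      exact: (measurableT_comp (mgD _ mA)).
    exact: (measurableT_comp (mgD _ mB)).
  - by move=> z; rewrite lee_fin !mulr_ge0// indicE.
  rewrite /fubini_F/=.
  transitivity (\int[mu]_x ((g x * \1_A x)%:E * gam B))%E.
    apply: eq_integral => x _; under eq_integral do rewrite EFinM.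
    rewrite ge0_integralZl//=; last 3 first.
    - by apply/measurable_EFinP; exact: mgD.
    - by move=> y _; rewrite lee_fin mulr_ge0.
    - by rewrite lee_fin mulr_ge0.
    by congr (_ * _)%E; rewrite /normal_prob [RHS]integral_mkcond gE.
  rewrite ge0_integralZr//=.
  - by congr (_ * _)%E; rewrite /normal_prob [RHS]integral_mkcond gE.
  - by apply/measurable_EFinP; exact: mgD.
  - by move=> y _; rewrite lee_fin mulr_ge0.
apply/funext => -[x y]; rewrite /patch in_setX !indicE /g2/=.
by case: (x \in A) (y \in B) => -[]; rewrite ?mulr1 ?mulr0 ?mul0r.
Qed.

Lemma normal_prod_rot c s (C : set (bR * bR)) : measurable C ->
  s != 0 -> c ^+ 2 + s ^+ 2 = 1 ->
  (gam \x gam)%E (planerot c s @^-1` C) = (gam \x gam)%E C.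
Proof.
move=> mC s0 cs; have mr := @measurable_planerot R c s.
have mpC : measurable (planerot c s @^-1` C).
  exact: (@measurable_preimageT _ _ (bR * bR)%type (bR * bR)%type).
rewrite !normal_prod_density//.
transitivity (\int[mu2]_(z in planerot c s @^-1` C) ((EFin \o g2) \o planerot c s) z)%E.
  have rotE (x y : R) : (c * x - s * y) ^+ 2 + (s * x + c * y) ^+ 2 = x ^+ 2 + y ^+ 2.
    rewrite -[RHS]mul1r -cs; ring.
  apply: eq_integral => -[x y] _.
  by rewrite /g2/= !normal_pdf0M rotE.
rewrite -(@ge0_integral_pushforward _ _ (bR * bR)%type (bR * bR)%type R
  (planerot c s) mr mu2 C (EFin \o g2) mC); first last.
- by move=> z _; rewrite lee_fin.
- by apply/measurable_EFinP; exact: measurable_funTS.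
by apply: eq_measure_integral => A mA _; exact: lebesgue_plane_rot.
Qed.

Lemma normal_prob_opp (A : set bR) : measurable A -> gam (-%R @^-1` A) = gam A.
Proof.
move=> mA; rewrite /normal_prob.
rewrite [RHS](@ge0_integral_opp _ A (fun x => (g x)%:E))//.
- by apply: eq_integral => x _; rewrite !normal_pdf0E sqrrN.
- by apply/measurable_EFinP; exact: measurable_funTS.
Qed.

End gauss_plane.

(** * Gaussian mass of intervals and disks *)

Section real_integrals.
Context (R : realType).
Notation bR := (measurableTypeR R).
Notation mu := (@lebesgue_measure R).

Lemma ge0_integral_even (f : R -> \bar R) (a : R) : 0 <= a ->
  measurable_fun setT (f : bR -> \bar R) -> (forall x, 0 <= f x)%E ->
  (forall x, f (- x)%R = f x) ->
  (\int[mu]_(x in `[(- a)%R, a]) f x = 2%:E * \int[mu]_(x in `[0%R, a]) f x)%E.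
Proof.
move=> a0 mf f0 fN.
have -> : `[- a, a]%classic = `[- a, 0]%classic `|` `]0, a]%classic.
  by rewrite -itv_bndbnd_setU// bnd_simp// oppr_le0.
rewrite ge0_integral_setU//=; last 2 first.
- exact: measurable_funTS.
- rewrite disj_set2E; apply/eqP; rewrite -subset0 => x []/=.
  by rewrite !in_itv/= => /andP[_ x0] /andP[]; rewrite ltNge x0.
rewrite integral_itv_obnd_cbnd; last exact: measurable_funTS.
have -> : (\int[mu]_(x in `[(- a)%R, 0%R]) f x = \int[mu]_(x in `[0%R, a]) f x)%E.
  rewrite [LHS]ge0_integral_opp//; last exact: measurable_funTS.
  rewrite opp_preimage_itvbndbnd/= oppr0 opprK.
  by apply: eq_integral => x _; exact: fN.
by rewrite -[X in (X + X)%E]mul1e -ge0_muleDl// -EFinD.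
Qed.

Lemma integral_mulr_gauss (b a : R) : 0 < b -> 0 <= a ->
  (\int[mu]_(x in `[0%R, a]) (x * expR (- (b * x ^+ 2)))%:E =
   ((1 - expR (- (b * a ^+ 2))) / (2 * b))%:E)%E.
Proof.
move=> b0; rewrite le_eqVlt => /predU1P[<-|a0].
  by rewrite set_itv1 integral_set1 expr0n/= mulr0 oppr0 expR0 subrr mul0r.
pose f (x : R) := x * expR (- (b * x ^+ 2)).
pose F (x : R) := - (2 * b)^-1 * expR (- (b * x ^+ 2)).
have dF (x : R) : is_derive x 1 F (f x).
  apply: is_derive_eq; rewrite /f /GRing.scale/=.
  field. by rewrite gt_eqF.
have cF : continuous F.
  by move=> x; apply/differentiable_continuous/derivable1_diffP; exact: ex_derive.
have cf : continuous f.
  move=> x; apply: cvgM; first exact: cvg_id.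
  apply: (@continuous_comp _ _ _ (fun x : R => - (b * x ^+ 2)) expR).
    apply: cvgN; apply: cvgM; [exact: cvg_cst|exact: exprn_continuous].
  exact: continuous_expR.
rewrite (@continuous_FTC2 _ f F)//.
- rewrite -EFinB /F expr0n/= mulr0 oppr0 expR0; congr (_%:E); ring.
- exact: continuous_subspaceT.
- split=> [x _||]; first exact: ex_derive.
  + by apply: cvg_at_right_filter; exact: cF.
  + by apply: cvg_at_left_filter; exact: cF.
- by move=> x _; rewrite derive1E; exact: derive_val.
Qed.

Lemma integralT_oneDsqr : (\int[mu]_x ((1 + x ^+ 2)^-1)%:E = pi%:E)%E.
Proof.
rewrite (ge0_symfun_integralT (f := fun x => (1 + x ^+ 2)^-1)).
- rewrite (_ : [set x | _] = `[0, +oo[%classic); last first.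
    by apply/seteqP; split => x /=; rewrite in_itv/= andbT.
  by rewrite integral0y_oneDsqr -EFinM mulrC divfK.
- by move=> x; rewrite invr_ge0 addr_ge0// sqr_ge0.
- exact: continuous_oneDsqrV.
- by move=> x /=; rewrite sqrrN.
Qed.

Lemma sqr_le_itv (t : R) : 0 <= t ->
  [set x : R | x ^+ 2 <= t] = `[- Num.sqrt t, Num.sqrt t]%classic.
Proof.
move=> t0; apply/seteqP; split => x /=.
  by rewrite in_itv/= -ler_norml -sqrtr_sqr => ?; rewrite ler_sqrt.
by rewrite in_itv/= -ler_norml -sqrtr_sqr ler_sqrt.
Qed.

Lemma measurable_disk (t : R) :
  measurable [set z : bR * bR | z.1 ^+ 2 + z.2 ^+ 2 <= t].
Proof.
pose q (z : bR * bR) : bR := z.1 ^+ 2 + z.2 ^+ 2.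
have mq : measurable_fun setT q.
  by apply: measurable_funD; apply: measurable_funX => //; exact: measurable_funP.
rewrite (_ : [set z | _] = q @^-1` `]-oo, t]%classic).
  exact: (@measurable_preimageT _ _ (bR * bR)%type bR).
by apply/seteqP; split => z /=; rewrite in_itv.
Qed.

End real_integrals.

Section normal_balls.
Context (R : realType) (sigma : R).
Context (sigma_gt0 : 0 < sigma).
Notation bR := (measurableTypeR R).
Notation mu := (@lebesgue_measure R).
Notation gam := (normal_prob 0 sigma).
Notation g := (normal_pdf 0 sigma).

Let s2 : 0 < 2 * sigma ^+ 2. Proof. by rewrite mulr_gt0// exprn_gt0. Qed.

Lemma normal_prob_sqr_le (t : R) : 0 <= t ->
  gam [set x | x ^+ 2 <= t] = (erf (Num.sqrt (t / (2 * sigma ^+ 2))))%:E.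
Proof.
(* The substitution [x = c * u] turns the normal density into [gauss_fun], up to the constant
   [1 / sqrt pi]; the evenness of [gauss_fun] then supplies the factor 2 of [erf]. *)
move=> t0; pose c := Num.sqrt (2 * sigma ^+ 2).
have c0 : 0 < c by rewrite sqrtr_gt0.
have c2 : c ^+ 2 = 2 * sigma ^+ 2 by rewrite sqr_sqrtr// ltW.
have a0 : 0 <= t / (2 * sigma ^+ 2) by rewrite divr_ge0// ltW.
have mg : measurable_fun setT (g : bR -> R) by exact: measurable_normal_pdf.
rewrite /normal_prob (@ge0_integral_dilate _ c)//; last 3 first.
- by rewrite sqr_le_itv.
- by apply/measurable_EFinP; exact: measurable_funTS.
- by move=> x; rewrite lee_fin normal_pdf_ge0.
have -> : ( *%R c @^-1` [set x | x ^+ 2 <= t]) =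
    `[- Num.sqrt (t / (2 * sigma ^+ 2)), Num.sqrt (t / (2 * sigma ^+ 2))]%classic.
  rewrite -sqr_le_itv//; apply/seteqP; split=> x /=;
  by rewrite exprMn c2 ler_pdivlMr// mulrC.
set a := Num.sqrt (t / _).
have mga : measurable_fun setT (gauss_fun : bR -> R) by exact: measurable_gauss_fun.
rewrite (eq_integral
    (fun x : bR => ((Num.sqrt pi * c)^-1)%:E * (gauss_fun x)%:E)%E); last first.
  move=> x _; rewrite -EFinM normal_pdf0E// sqrtrM ?(ltW s2)// -/c mulrC (mulrC c).
  congr (_%:E).
  rewrite [RHS]mulrC [Num.sqrt pi * c]mulrC; congr (expR _ * _).
  by rewrite exprMn c2; field; rewrite gt_eqF.
rewrite ge0_integralZl//=; last 3 first.
- by apply/measurable_EFinP; exact: measurable_funTS.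
- by move=> x _; rewrite lee_fin gauss_fun_ge0.
- by rewrite lee_fin invr_ge0 mulr_ge0 ?sqrtr_ge0.
rewrite ge0_integral_even ?sqrtr_ge0//; last 3 first.
- by apply/measurable_EFinP.
- by move=> x; rewrite lee_fin gauss_fun_ge0.
- by move=> x; rewrite /gauss_fun sqrrN.
rewrite /erf sqrtr_ge0 /Rintegral.
have fin : (\int[mu]_(x in `[0%R, a]) (gauss_fun x)%:E \is a fin_num)%E.
  apply: integrable_fin_num => //.
  by apply: (integrableS _ _ (@subsetT _ _) (@integrableT_gauss R)).
rewrite -[X in (_ * (_ * (_ * X)))%E](fineK fin) -!EFinM; congr (_%:E).
rewrite !mulrA; congr (_ * _).
by rewrite invfM mulrCA divff ?gt_eqF// mulr1 mulrC.
Qed.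

Lemma normal_prod_disk (t : R) : 0 <= t ->
  (gam \x gam)%E [set z : bR * bR | z.1 ^+ 2 + z.2 ^+ 2 <= t] =
  (1 - expR (- (t / (2 * sigma ^+ 2))))%:E.
Proof.
move=> t0; set D := [set z | _].
pose q (z : bR * bR) : R := z.1 ^+ 2 + z.2 ^+ 2.
have mq : measurable_fun setT q.
  by apply: measurable_funD; apply: measurable_funX => //; exact: measurable_funP.
have mD : measurable D by exact: measurable_disk.
rewrite normal_prod_density// integral_mkcond.
pose k := (2 * sigma ^+ 2 * pi)^-1 : R.
have k0 : 0 <= k by rewrite invr_ge0 mulr_ge0 ?pi_ge0// ltW.
(* The indicator of the disk is absorbed into the radial profile, so that Tonelli and the dilations
   act on full lines. *)
pose h (r : R) : R := k * expR (- r / (2 * sigma ^+ 2)) * (r <= t)%R%:R.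
have h0 r : 0 <= h r by rewrite !mulr_ge0// expR_ge0.
have mh : measurable_fun setT (h : bR -> R).
  apply: measurable_funM; last first.
    rewrite (_ : (fun _ => _) = \1_`]-oo, t]%classic).
      exact: measurable_indic.
    by apply/funext => x; rewrite indicE; congr (_%:R); rewrite mem_setE in_itv.
  apply: measurable_funM; first exact: measurable_cst.
  apply: measurableT_comp => //; apply: measurable_funM; last exact: measurable_cst.
  exact: oppr_measurable.
rewrite (_ : _ \_ D = fun z => (h (q z))%:E); last first.
  apply/funext => z; rewrite /patch /h normal_pdf0M// -/(q z) -/k.
  case: ifPn => [/set_mem zt|zD]; first by rewrite (_ : q z <= t) ?mulr1.
  rewrite (_ : (q z <= t) = false) ?mulr0//.
  by apply/negP => /mem_set zt; move/negP: zD; exact.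
have mhq d (T : measurableType d) (f : T -> bR) : measurable_fun setT f ->
    measurable_fun setT (fun z => (h (f z))%:E).
  by move=> mf; apply/measurable_EFinP; exact: (measurableT_comp mh).
rewrite fubini_tonelli1/=; last 2 first.
- exact: mhq.
- by move=> z; rewrite lee_fin.
rewrite /fubini_F/=.
pose G (z : bR * bR) : R := `|z.1| * h (z.1 ^+ 2 * (1 + z.2 ^+ 2)).
have mG : measurable_fun setT G.
  apply: measurable_funM; first by apply: measurableT_comp.
  apply: (measurableT_comp mh); apply: measurable_funM.
    by apply: measurable_funX; exact: measurable_fst.
  apply: measurable_funD; first exact: measurable_cst.
  by apply: measurable_funX; exact: measurable_snd.
have G0 z : 0 <= G z by rewrite mulr_ge0.
(* the substitution y = |x| v *)
transitivity (\int[mu]_x \int[mu]_v (G (x, v))%:E)%E.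
  (* The dilation by [|x|] degenerates at [x = 0], so this null set is removed on both sides. *)
  rewrite -[LHS](@integral_setD1 _ _ 0); last 2 first.
  - exact: measurableD.
  - apply: measurable_funTS.
    apply: (@measurable_fun_fubini_tonelli_F _ _ bR bR R mu
      (fun z => (h (q z))%:E)) => [|z].
      exact: mhq.
    by rewrite lee_fin.
  rewrite -[RHS](@integral_setD1 _ _ 0); last 2 first.
  - exact: measurableD.
  - apply: measurable_funTS.
    apply: (@measurable_fun_fubini_tonelli_F _ _ bR bR R mu
      (fun z => (G z)%:E)) => [|z].
      exact/measurable_EFinP.
    by rewrite lee_fin.
  apply: eq_integral => x /set_mem[_ /= /eqP x0].
  have nx : 0 < `|x| by rewrite normr_gt0.
  have mqx : measurable_fun setT (fun y : bR => q (x, y) : bR).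
    by apply: (measurableT_comp mq); exact: measurable_fun_pair.
  rewrite (@ge0_integral_dilate _ `|x|)//; last 2 first.
  - exact: mhq.
  - by move=> y; rewrite lee_fin.
  rewrite preimage_setT -ge0_integralZl//=; last 2 first.
  - apply: mhq; apply: (measurableT_comp mq); apply: measurable_fun_pair.
      exact: measurable_cst.
    exact: measurable_mulrr.
  - by move=> y _; rewrite lee_fin.
  apply: eq_integral => v _; rewrite -EFinM; congr (_%:E).
  rewrite /G/=; congr (_ * h _).
  by rewrite /q/= exprMn real_normK ?num_real// mulrDr mulr1.
(* Integrating in [x] first exploits the Jacobian [|x|]: it gives the Gaussian an elementary
   antiderivative. *)
rewrite (@fubini_tonelli _ _ bR bR R mu mu (EFin \o G))/=; last 2 first.
- exact/measurable_EFinP.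
- by move=> z; rewrite lee_fin.
transitivity (\int[mu]_v
    (((1 - expR (- (t / (2 * sigma ^+ 2)))) / pi)%:E * ((1 + v ^+ 2)^-1)%:E))%E.
  apply: eq_integral => v _.
  have v1 : 0 < 1 + v ^+ 2 by rewrite ltr_pwDl// sqr_ge0.
  (* For fixed [v] the disk becomes [|x| <= a]. Since [b * a ^+ 2] does not depend on [v], only the
     factor [1 / (1 + v ^+ 2)] does, and its integral [pi] cancels the one in the density. *)
  pose a := Num.sqrt (t / (1 + v ^+ 2)).
  have a2 : a ^+ 2 = t / (1 + v ^+ 2) by rewrite sqr_sqrtr// divr_ge0// ltW.
  pose b := (1 + v ^+ 2) / (2 * sigma ^+ 2).
  have b0 : 0 < b by rewrite divr_gt0.
  transitivity (\int[mu]_(x in `[(- a)%R, a])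
      (k * (`|x| * expR (- (b * x ^+ 2))))%:E)%E.
    rewrite [RHS]integral_mkcond; apply: eq_integral => x _.
    have xE : (x \in `[- a, a]%classic) = (x ^+ 2 * (1 + v ^+ 2) <= t).
      rewrite -sqr_le_itv ?divr_ge0 ?(ltW v1)// -ler_pdivlMr//.
      by apply/idP/idP => [/set_mem//|xt]; apply/mem_set.
    rewrite /patch xE /G /h/=; case: ifPn => _; last by rewrite !mulr0.
    rewrite mulr1 mulrCA; congr (k * (_ * expR _))%:E.
    by rewrite /b mulNr [in RHS]mulrAC (mulrC (x ^+ 2)).
  have mx : measurable_fun setT (fun x : bR => `|x| * expR (- (b * x ^+ 2))).
    apply: measurable_funM; first exact: normr_measurable.
    apply: measurableT_comp => //; apply: measurableT_comp => //.
    apply: measurable_funM; [exact: measurable_cst|exact: measurable_funX].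
  rewrite ge0_integral_even ?sqrtr_ge0//; last 3 first.
  - by apply/measurable_EFinP; apply: measurable_funM; [exact: measurable_cst|].
  - by move=> x; rewrite lee_fin !mulr_ge0// expR_ge0.
  - by move=> x; rewrite normrN sqrrN.
  rewrite (eq_integral
      (fun x : bR => k%:E * (x * expR (- (b * x ^+ 2)))%:E)%E); last first.
    move=> x /set_mem/=; rewrite in_itv/= => /andP[x0 _].
    by rewrite ger0_norm// EFinM.
  rewrite ge0_integralZl//=; last 2 first.
  - apply/measurable_EFinP; apply: measurable_funTS; apply: measurable_funM => //.
    apply: measurableT_comp => //; apply: measurableT_comp => //.
    apply: measurable_funM; [exact: measurable_cst|exact: measurable_funX].
  - move=> x; rewrite in_itv/= => /andP[x0 _].
    by rewrite lee_fin mulr_ge0// expR_ge0.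
  rewrite integral_mulr_gauss ?sqrtr_ge0// -!EFinM; congr (_%:E).
  have -> : b * a ^+ 2 = t / (2 * sigma ^+ 2).
    by rewrite a2 /b; field; rewrite !gt_eqF.
  have : (pi : R) != 0 by rewrite gt_eqF// pi_gt0.
  rewrite /b /k; move: (pi : R) => p p0; field.
  by rewrite p0 !gt_eqF.
rewrite ge0_integralZl//=; last 3 first.
- apply/measurable_EFinP; apply: continuous_measurable_fun; exact: continuous_oneDsqrV.
- by move=> x _; rewrite lee_fin invr_ge0 addr_ge0// sqr_ge0.
- rewrite lee_fin divr_ge0 ?pi_ge0// subr_ge0 -[leRHS]expR0 ler_expR oppr_le0.
  by rewrite divr_ge0// ltW.
by rewrite integralT_oneDsqr -EFinM divfK// gt_eqF// pi_gt0.
Qed.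

End normal_balls.

(** * Orthogonal transforms of Gaussian families *)

(** Stated for functions on an index type, so that it acts alike on the columns of a matrix and on
    the values of a random family. *)
Definition plane_rot (I : eqType) (R : pzRingType) (i j : I) (c s : R)
    (v : I -> R) (k : I) : R :=
  if k == i then c * v i - s * v j
  else if k == j then s * v i + c * v j else v k.

Definition flip (I : eqType) (V : zmodType) (i : I) (v : I -> V) (k : I) : V :=
  if k == i then - v i else v k.

Section givens.
Context (R : rcfType) (n : nat).
Implicit Types A : 'I_n -> 'I_n -> R.

(** Row operations by rotations and flips preserve the inner products of columns, hence the
    formulation by columns. *)
Definition orthonormal_cols A :=
  forall l l', \sum_k A k l * A k l' = (l == l')%:R.

Definition row_rot i j c s A : 'I_n -> 'I_n -> R :=
  fun k l => plane_rot i j c s (A^~ l) k.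
Definition row_flip i A : 'I_n -> 'I_n -> R := fun k l => flip i (A^~ l) k.

Lemma orthonormal_cols_rot i j c s A : i != j -> c ^+ 2 + s ^+ 2 = 1 ->
  orthonormal_cols A -> orthonormal_cols (row_rot i j c s A).
Proof.
move=> ij cs oA l l'; rewrite -oA.
rewrite (bigD1 i)//= (bigD1 j) 1?eq_sym//=.
rewrite [in RHS](bigD1 i)//= [in RHS](bigD1 j) 1?eq_sym//=.
rewrite !addrA; congr (_ + _).
  rewrite /row_rot /plane_rot !eqxx eq_sym (negbTE ij)/=.
  rewrite -[RHS]mul1r -cs; ring.
apply: eq_bigr => k /andP[ki kj].
by rewrite /row_rot /plane_rot (negbTE ki) (negbTE kj).
Qed.

Lemma orthonormal_cols_flip i A :
  orthonormal_cols A -> orthonormal_cols (row_flip i A).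
Proof.
move=> oA l l'; rewrite -oA; apply: eq_bigr => k _.
by rewrite /row_flip /flip; case: eqP => [->|//]; rewrite mulrNN.
Qed.

(* Givens elimination: rotations clear the columns from left to right; a
   cleared column is a basis vector, so by orthonormality its row is cleared as
   well and later rotations do not disturb it. *)
Lemma orthonormal_ind (S : ('I_n -> 'I_n -> R) -> Prop) :
  (forall A, (forall k l, A k l = (k == l)%:R) -> S A) ->
  (forall i A, S (row_flip i A) -> S A) ->
  (forall i j c s A, i != j -> s != 0 -> c ^+ 2 + s ^+ 2 = 1 ->
     S (row_rot i j c s A) -> S A) ->
  forall A, orthonormal_cols A -> S A.
Proof.
move=> S1 Sflip Srot.
(* [m] counts the columns still to be cleared: the first [n - m] already agree with the identity. *)
suff H m : forall A, orthonormal_cols A ->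
    (forall k l : 'I_n, (l < n - m)%N -> A k l = (k == l)%:R) -> S A.
  by move=> A oA; apply: (H n) => // k l; rewrite subnn.
elim: m => [|m IH] A oA HA.
  by apply: S1 => k l; apply: HA; rewrite subn0.
case: (ltnP m n) => mn; last first.
  by apply: IH => // k l; rewrite (eqP (mn : (n - m == 0)%N)).
have Hp : (n - m.+1 < n)%N by rewrite ltn_subrL /= (leq_ltn_trans _ mn).
pose p := Ordinal Hp.
(* Inner induction on the number of nonzero off-diagonal entries of column [p]; each rotation kills
   one and leaves the other off-diagonal entries of that column alone. *)
have [z] := ubnP #|[pred i | (i != p) && (A i p != 0)]|.
elim: z => // z IHz in A oA HA *; rewrite ltnS => Hz.
have row0 (k l : 'I_n) : (l < n - m.+1)%N -> (n - m.+1 <= k)%N -> A k l = 0.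
  by move=> lp pk; rewrite HA//; case: eqP => // kl; move: lp; rewrite -kl ltnNge pk.
have col0 (i : 'I_n) : (i < n - m.+1)%N -> A i p = 0.
  move=> ip; have := oA i p; rewrite (bigD1 i)//= big1 ?addr0.
    rewrite HA// eqxx mul1r => ->; case: eqP => // /(congr1 val) /= E.
    by move: ip; rewrite E ltnn.
  by move=> k ki; rewrite HA// (negbTE ki) mul0r.
(* With no such entry left, the unit norm of column [p] forces [A p p] to be 1 or -1, and a flip
   repairs the sign. *)
have [i /andP[ip Aip]|Az] := pickP [pred i | (i != p) && (A i p != 0)]; last first.
  have Apz (i : 'I_n) : i != p -> A i p = 0.
    by move=> ip; have := Az i; rewrite /= ip => /negbFE/eqP.
  have App : A p p ^+ 2 = 1.
    have := oA p p; rewrite eqxx (bigD1 p)//= big1 ?addr0// => i /Apz ->.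
    by rewrite mul0r.
  have done1 A' : orthonormal_cols A' ->
     (forall k l : 'I_n, (l < n - m.+1)%N -> A' k l = (k == l)%:R) ->
     (forall i, i != p -> A' i p = 0) -> A' p p = 1 -> S A'.
    move=> oA' HA' A'z A'p; apply: IH => // k l lm.
    have [/HA' //|ge] := ltnP l (n - m.+1).
    have -> : l = p.
      by apply/val_inj => /=; apply/eqP; rewrite eqn_leq ge andbT -ltnS -subSn.
    by case: eqVneq => [->|/A'z].
  have /orP[/eqP Ap|/eqP Ap] : (A p p == 1) || (A p p == -1) by rewrite -sqrf_eq1 App.
    exact: done1.
  apply: (Sflip p); apply: done1.
  - exact: orthonormal_cols_flip.
  - move=> k l lp; rewrite /row_flip /flip; case: eqP => [->|_]; last exact: HA.
    rewrite row0// oppr0; case: eqP => // /(congr1 val)/= E.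
    by move: lp; rewrite -E ltnn.
  - by move=> i ip; rewrite /row_flip /flip (negbTE ip) Apz.
  - by rewrite /row_flip /flip eqxx Ap opprK.
(* The rotation sends the entries [(a, b)] to [(r, 0)]. As [b] is nonzero, [r] is positive and the
   sine [- b / r] is nonzero. *)
pose a := A p p; pose b := A i p; pose r := Num.sqrt (a ^+ 2 + b ^+ 2).
have ab0 : 0 < a ^+ 2 + b ^+ 2.
  by rewrite ltr_wpDl ?sqr_ge0// exprn_even_gt0.
have r0 : r != 0 by rewrite gt_eqF// sqrtr_gt0.
have r2 : r ^+ 2 = a ^+ 2 + b ^+ 2 by rewrite sqr_sqrtr// ltW.
have pi_ : p != i by rewrite eq_sym.
have cs : (a / r) ^+ 2 + (- b / r) ^+ 2 = 1.
  by rewrite !exprMn sqrrN -mulrDl -r2 -exprMn divff// expr1n.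
apply: (Srot p i (a / r) (- b / r)) => //.
  by rewrite mulf_neq0 ?oppr_eq0 ?invr_eq0.
have rip : row_rot p i (a / r) (- b / r) A i p = 0.
  rewrite /row_rot /plane_rot (negbTE ip) eqxx/= -/a -/b.
  by rewrite mulrAC [X in _ + X]mulrAC -mulrDl mulNr (mulrC b) addNr mul0r.
have pli : (n - m.+1 <= i)%N.
  by rewrite leqNgt; apply/negP => /col0 /eqP; rewrite (negbTE Aip).
apply: IHz.
- exact: orthonormal_cols_rot.
- move=> k l lp; rewrite /row_rot /plane_rot/=.
  have Ap : A p l = 0 by exact: row0.
  have Ai : A i l = 0 by exact: row0.
  rewrite Ap Ai !mulr0 subr0 addr0.
  case: eqP => [->|_].
    by case: eqP => // /(congr1 val)/= E; move: lp; rewrite -E ltnn.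
  case: eqP => [->|_]; last exact: HA.
  by case: eqP => // E; move: lp; rewrite -E ltnNge pli.
- apply: leq_trans Hz; apply: proper_card; apply/properP; split.
    apply/fintype.subsetP => k; rewrite !inE => /andP[kp]; rewrite kp.
    rewrite /row_rot /plane_rot (negbTE kp); case: (eqVneq k i) => [->|//] _.
    exact: Aip.
  by exists i; rewrite !inE ip//= rip eqxx.
Qed.

End givens.

Section gauss_orthogonal.
Context (R : realType) (sigma : R) (d : measure_display) (T : measurableType d).
Context (P : probability T R).
Context (sigma_gt0 : 0 < sigma).
Notation bR := (measurableTypeR R).
Notation jl := (joint_law P (normal_prob 0 sigma : probability bR R)).

Lemma joint_law_eq (I : finType) (X Y : I -> T -> bR) :
  (forall i w, X i w = Y i w) -> jl X -> jl Y.
Proof. by move=> XY; have -> : X = Y by apply/funext => i; apply/funext => w. Qed.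

Lemma joint_law_flip (I : finType) (X : I -> T -> bR) i :
  jl X -> jl (fun k w => flip i (X^~ w) k).
Proof.
move=> [mX jX]; split=> [k|B mB].
  by rewrite /flip; case: eqP => // _; apply: measurableT_comp.
pose B' k := if k == i then -%R @^-1` B k else B k.
rewrite (_ : [set w | _] = [set w | forall k, B' k (X k w)]); last first.
  apply/seteqP; split => w /= h k; have := h k;
  by rewrite /B' /flip; case: eqP => // ->.
rewrite jX => [|k]; last first.
  rewrite /B'; case: eqP => // _; exact: (@measurable_preimageT _ _ bR bR).
apply: eq_bigr => k _; rewrite /B'; case: eqP => // _.
exact: normal_prob_opp.
Qed.

(** A box constraint on the rotated family pulls back to a planar set [C] at the pair [(i, j)] and
    to the same box elsewhere; the planar Gaussian gives [C] the mass of the original rectangle. *)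
Lemma joint_law_rot (I : finType) (X : I -> T -> bR) i j c s :
  i != j -> s != 0 -> c ^+ 2 + s ^+ 2 = 1 ->
  jl X -> jl (fun k w => plane_rot i j c s (X^~ w) k).
Proof.
move=> ij s0 cs jX; have [mX _] := jX; split=> [k|B mB].
  rewrite /plane_rot/=; case: eqP => _.
    by apply: measurable_funB;
      (apply: measurable_funM; [exact: measurable_cst|exact: mX]).
  case: eqP => // _.
  by apply: measurable_funD;
    (apply: measurable_funM; [exact: measurable_cst|exact: mX]).
pose C := planerot c s @^-1` (B i `*` B j).
have mBB : measurable (B i `*` B j) by exact: measurableX.
have mC : measurable C.
  apply: (@measurable_preimageT _ _ (bR * bR)%type (bR * bR)%type) => //.
  exact: measurable_planerot.
have := @joint_law_pairs R d _ T bR P (normal_prob 0 sigma) I X jX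
  [:: (i, j)] (fun=> C) B.
rewrite /= inE ij => /(_ isT (fun=> mC) mB).
rewrite (_ : [set w | _] = [set w | forall k, B k (plane_rot i j c s (X^~ w) k)]).
  move=> ->; rewrite big_seq1 normal_prod_rot// product_measure1E//.
  rewrite [RHS](bigD1 i)//= [in RHS](bigD1 j) 1?eq_sym//= [in RHS]muleA.
  congr (_ * _)%E.
  by apply: eq_bigl => k; rewrite !inE negb_or.
apply/seteqP; split => w /=.
  move=> [h1 h2] k; rewrite /plane_rot.
  have [/= hi hj] := h1 (i, j) (mem_head _ _).
  case: eqP => [->//|/eqP ki]; case: eqP => [->//|/eqP kj].
  by apply: h2; rewrite !inE negb_or ki kj.
move=> h; split=> [q|k].
  rewrite inE => /eqP -> /=; split=> /=.
    by have := h i; rewrite /plane_rot eqxx.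
  by have := h j; rewrite /plane_rot eqxx eq_sym (negbTE ij).
rewrite !inE negb_or => /andP[ki kj].
by have := h k; rewrite /plane_rot (negbTE ki) (negbTE kj).
Qed.

Lemma joint_law_orthogonal n (A : 'I_n -> 'I_n -> R) (X : 'I_n -> T -> bR) :
  orthonormal_cols A -> jl X -> jl (fun k w => \sum_l A k l * X l w).
Proof.
move=> oA jX; move: A oA; apply: orthonormal_ind.
- move=> A A1; apply: joint_law_eq jX => i w /=.
  rewrite (bigD1 i)//= A1 eqxx mul1r big1 ?addr0// => j ji.
  by rewrite A1 eq_sym (negbTE ji) mul0r.
- move=> i A /(joint_law_flip i); apply: joint_law_eq => k w /=.
  rewrite /row_flip /flip eqxx; case: eqP => // ->.
  by rewrite -sumrN; apply: eq_bigr => l _; rewrite mulNr opprK.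
- move=> i j c s A ij s0 cs.
  (* The induction provides the law for the rotated matrix, so the inverse rotation, with sine
     [- s], recovers the one for [A]. *)
  have s0' : - s != 0 by rewrite oppr_eq0.
  have cs' : c ^+ 2 + (- s) ^+ 2 = 1 by rewrite sqrrN.
  move=> /(joint_law_rot ij s0' cs'); apply: joint_law_eq => k w /=.
  rewrite /row_rot /plane_rot !eqxx (eq_sym j) (negbTE ij)/=.
  have e1 : \sum_l (c * A i l - s * A j l) * X l w =
      c * (\sum_l A i l * X l w) - s * (\sum_l A j l * X l w).
    rewrite !mulr_sumr -sumrB; apply: eq_bigr => l _; ring.
  have e2 : \sum_l (s * A i l + c * A j l) * X l w =
      s * (\sum_l A i l * X l w) + c * (\sum_l A j l * X l w).
    rewrite !mulr_sumr -big_split; apply: eq_bigr => l _ /=; ring.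
  rewrite e1 e2.
  case: eqP => [->|_]; first by rewrite -[RHS]mul1r -cs; ring.
  by case: eqP => [->|//]; rewrite -[RHS]mul1r -cs; ring.
Qed.

End gauss_orthogonal.

(** * The Hartley transform *)

Section hartley.
Local Open Scope complex_scope.
Context (R : realType) (N : nat).
Context (N_gt0 : (0 < N)%N).
Local Notation theta m := (2 * pi * m%:R / N%:R : R).

Let N0 : N%:R != 0 :> R. Proof. by rewrite pnatr_eq0 -lt0n. Qed.

Lemma theta_mulN k : theta (k * N)%N = (pi *+ 2) *+ k.
Proof. by rewrite natrM mulrA mulfK// -(mulr_natl pi 2) mulr_natr. Qed.

(** The reflection of [k] to [N - k] changes the sign of the sum; the vanishing term [k = N] is
    added to make the range symmetric. *)
Lemma sum_sin_theta m : \sum_(k < N) sin (theta (k * m)%N) = 0.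
Proof.
have -> : \sum_(k < N) sin (theta (k * m)%N) =
    \sum_(k < N.+1) sin (theta (k * m)%N).
  rewrite big_ord_recr/= mulnC theta_mulN.
  by rewrite -[X in sin X]add0r (periodicn (@sinD2pi R)) sin0 addr0.
have : \sum_(k < N.+1) sin (theta (k * m)%N) =
    - \sum_(k < N.+1) sin (theta (k * m)%N).
  rewrite [LHS](reindex_inj rev_ord_inj)/= -sumrN; apply: eq_bigr => k _.
  rewrite -sinN -[RHS](periodicn (@sinD2pi R) m) -theta_mulN; congr sin.
  rewrite subSS mulnBl natrB; last by rewrite leq_mul2r -ltnS ltn_ord orbT.
  by rewrite (mulnC N m) mulrBr mulrBl addrC.
lra.
Qed.

Lemma sum_cos_theta m : (0 < m < N)%N -> \sum_(k < N) cos (theta (k * m)%N) = 0.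
Proof.
move=> /andP[m0 mN].
(* [h] is half the angular step. Multiplication by [2 * sin h], nonzero because [h] lies strictly
   between 0 and [pi], makes the sum telescope, and the two ends cancel by periodicity. *)
pose h : R := pi * m%:R / N%:R.
have sh0 : sin h != 0.
  rewrite gt_eqF// sin_gt0_pi//; rewrite /h -mulrA; apply/andP; split.
    by rewrite mulr_gt0 ?pi_gt0// divr_gt0 ?ltr0n.
  by rewrite gtr_pMr ?pi_gt0// ltr_pdivrMr ?ltr0n// mul1r ltr_nat.
have tE k : theta (k * m)%N = (h *+ 2) *+ k.
  by rewrite natrM /h -[in RHS]mulr_natl -[RHS]mulr_natl; ring.
have tel n : 2 * sin h * (\sum_(k < n) cos (theta (k * m)%N)) =
    sin ((h *+ 2) *+ n - h) + sin h.
  elim: n => [|n IH]; first by rewrite big_ord0 mulr0 mulr0n sub0r sinN addNr.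
  rewrite big_ord_recr/= mulrDr IH tE.
  have -> : (h *+ 2) *+ n.+1 - h = (h *+ 2) *+ n + h.
    by rewrite (mulrSr (h *+ 2) n) -addrA; congr (_ + _); rewrite mulr2n addrK.
  rewrite (sinD _ h) sinB; ring.
apply: (mulfI (_ : 2 * sin h != 0)); first by rewrite mulf_neq0.
rewrite mulr0 tel -tE mulnC theta_mulN.
by rewrite (addrC _ (- h)) (periodicn (@sinD2pi R)) sinN addNr.
Qed.

Definition cas (x : R) : R := cos x + sin x.

(** In the inner product of two columns the sine part always sums to 0, and the cosine part sums to
    0 unless the columns coincide. *)
Lemma casM x y : cas x * cas y = cos (x - y) + sin (x + y).
Proof. rewrite /cas cosB sinD; ring. Qed.

Definition hartley (k n : 'I_N) : R := cas (theta (k * n)%N) / Num.sqrt N%:R.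

Lemma hartley_orthonormal : orthonormal_cols hartley.
Proof.
move=> l l'; rewrite /hartley.
have N0' : 0 <= N%:R :> R by rewrite ler0n.
transitivity (N%:R^-1 * (\sum_(k < N) cos (theta (k * l)%N - theta (k * l')%N)
                         + \sum_(k < N) sin (theta (k * (l + l'))%N))).
  rewrite -big_split mulr_sumr; apply: eq_bigr => k _ /=.
  rewrite mulrACA -invfM -expr2 sqr_sqrtr// casM mulrC; congr (_ * (_ + sin _)).
  by rewrite mulnDr natrD; ring.
rewrite sum_sin_theta addr0.
have cosz (a b : 'I_N) : (a < b)%N ->
    \sum_(k < N) cos (theta (k * b)%N - theta (k * a)%N) = 0.
  move=> ab; rewrite -[RHS](@sum_cos_theta (b - a)); last first.
    by rewrite subn_gt0 ab (leq_ltn_trans (leq_subr _ _)).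
  apply: eq_bigr => k _; congr cos.
  by rewrite mulnBr natrB ?leq_mul2l ?(ltnW ab) ?orbT//; ring.
case: (ltngtP l l') => [ll|ll|/val_inj ->].
- rewrite (eq_bigr (fun k : 'I_N => cos (theta (k * l')%N - theta (k * l)%N))).
    by rewrite cosz// mulr0; case: eqP => // E; move: ll; rewrite E ltnn.
  by move=> k _; rewrite -cosN opprB.
- by rewrite cosz// mulr0; case: eqP => // E; move: ll; rewrite E ltnn.
- rewrite eqxx (eq_bigr (fun=> 1)); last by move=> k _; rewrite subrr cos0.
  by rewrite sumr_const card_ord mulVf.
Qed.

Lemma dft_re_im (x : 'I_N -> R) k :
  dft (realvec x) k = (N%:R^-1 * \sum_(n < N) cos (theta (k * n)%N) * x n) +i*
     (- (N%:R^-1 * \sum_(n < N) sin (theta (k * n)%N) * x n)).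
Proof.
rewrite /dft.
have -> : \sum_(n < N) cis (- (2 * pi * k%:R * n%:R / N%:R)) * realvec x n 0 =
    (\sum_(n < N) cos (theta (k * n)%N) * x n) +i*
    (- \sum_(n < N) sin (theta (k * n)%N) * x n).
  rewrite -sumrN; elim/big_rec3: _ => // n a b z _ ->.
  rewrite mxE /cis natrM mulrA cosN sinN.
  by apply/eqP; rewrite eq_complex/= !mulr0 subr0 add0r !mulNr !eqxx.
rewrite -(rmorph_nat (real_complex R)) -fmorphV.
by apply/eqP; rewrite eq_complex/= !mul0r subr0 addr0 mulrN !eqxx.
Qed.

Lemma normc_sqr (z : R[i]) :
  ComplexField.Normc.normc z ^+ 2 = complex.Re z ^+ 2 + complex.Im z ^+ 2.
Proof. by case: z => a b /=; rewrite sqr_sqrtr ?addr_ge0 ?sqr_ge0. Qed.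

(** With [a] and [b] the cosine and sine sums, the coordinates at [k] and [k'] are [a + b] and
    [a - b] up to scaling, and their squares add up to twice [a ^+ 2 + b ^+ 2]. The divisibility
    also admits [k' = k] in the bins 0 and N/2. *)
Lemma dft_power_hartley (x : 'I_N -> R) (k k' : 'I_N) : (N %| k + k')%N ->
  ComplexField.Normc.normc (dft (realvec x) k) ^+ 2 =
  ((\sum_n hartley k n * x n) ^+ 2 + (\sum_n hartley k' n * x n) ^+ 2) / (2 * N%:R).
Proof.
move=> /dvdnP[q qE]; rewrite normc_sqr dft_re_im/=.
set a := \sum_n cos _ * _; set b := \sum_n sin _ * _.
have hk : \sum_n hartley k n * x n = (a + b) / Num.sqrt N%:R.
  rewrite -big_split mulr_suml; apply: eq_bigr => n _ /=.
  by rewrite /hartley /cas -mulrDl mulrAC.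
have hk' : \sum_n hartley k' n * x n = (a - b) / Num.sqrt N%:R.
  rewrite -sumrB mulr_suml; apply: eq_bigr => n _ /=.
  rewrite /hartley -mulrBl [RHS]mulrAC; congr (_ / _ * _).
  have -> : theta (k' * n)%N = - theta (k * n)%N + (pi *+ 2) *+ (q * n)%N.
    rewrite -theta_mulN mulnAC -qE mulnDl natrD; ring.
  by rewrite /cas (periodicn (@cosD2pi R)) (periodicn (@sinD2pi R)) cosN sinN.
rewrite hk hk' !exprMn !exprVn sqr_sqrtr ?ler0n//.
by field.
Qed.

End hartley.

(** * Distribution of the spectral maxima *)

Lemma prode_const (R : realType) (I : Type) (s : seq I) (x : R) :
  (\prod_(i <- s) x%:E = (x ^+ size s)%:E)%E.
Proof. by elim: s => [|a s IH]; rewrite ?big_nil// big_cons IH -EFinM -exprS. Qed.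

Lemma iid_joint_law (R : realType) (d : measure_display) (T : measurableType d)
    (P : probability T R) (N : nat) (sigma : R) (X : 'I_N -> {RV P >-> R}) :
  iid_centered_normal sigma X ->
  joint_law P (normal_prob 0 sigma : probability (measurableTypeR R) R)
    (fun i => X i : T -> R).
Proof.
move=> [indep law]; split=> [i|B mB]; first exact: (measurable_funPT (X i)).
have := indep [set: 'I_N]%SET B mB.
rewrite (_ : \bigcap_(i in _) _ = [set w | forall i, B i (X i w)]).
  move=> ->; rewrite (eq_bigl xpredT) => [|i]; last by rewrite inE.
  by apply: eq_bigr => i _; exact: law (mB i).
apply/seteqP; split => w h i; last by move=> _; exact: h.
by apply: (h i); rewrite /= finset.in_setT.
Qed.

Section spectrum.
Context (R : realType) (d : measure_display) (T : measurableType d).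
Context (N : nat) (N_ge2 : (2 <= N)%N) (N_even : ~~ odd N).
Notation bR := (measurableTypeR R).

Let N_gt0 : (0 < N)%N. Proof. exact: ltnW. Qed.
Let h := N./2.
Let Nh : N = (h + h)%N. Proof. by rewrite addnn even_halfK. Qed.
Let h_gt0 : (0 < h)%N. Proof. by move: N_ge2; rewrite Nh; lia. Qed.

Definition ordm (k : nat) : 'I_N := Ordinal (ltn_pmod k N_gt0).

Lemma ordmE k : (k < N)%N -> ordm k = k :> nat.
Proof. exact: modn_small. Qed.

(** A common form for the three maxima: [b] tells whether bin 0 counts, [t1] bounds the self-paired
    bins and [t2] the conjugate pairs. *)
Definition spectral_event (Y : 'I_N -> T -> bR) (b : bool) (t1 t2 : R) : set T :=
  [set w | [/\ b -> Y (ordm 0) w ^+ 2 <= t1, Y (ordm h) w ^+ 2 <= t1 &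
    forall k k' : 'I_N, (0 < k < h)%N -> (k + k')%N = N ->
      Y k w ^+ 2 + Y k' w ^+ 2 <= t2]].

Lemma spectral_event_prob (P : probability T R) (sigma : R)
    (Y : 'I_N -> T -> bR) b t1 t2 :
  0 < sigma -> joint_law P (normal_prob 0 sigma : probability bR R) Y ->
  0 <= t1 -> 0 <= t2 ->
  P (spectral_event Y b t1 t2) =
  (erf (Num.sqrt (t1 / (2 * sigma ^+ 2))) ^+ b.+1 *
   (1 - expR (- (t2 / (2 * sigma ^+ 2)))) ^+ (h - 1))%:E.
Proof.
move=> sigma_gt0 jY t10 t20.
(* These [h - 1] pairs (none when [N = 2]) leave out exactly the indices 0 and [h], which are
   constrained singly through [B]. *)
pose s := [seq (ordm k, ordm (N - k)) | k <- iota 1 (h - 1)].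
have sP q : q \in s -> (0 < q.1 < h)%N /\ (q.1 + q.2)%N = N.
  case/mapP => k; rewrite mem_iota => hk -> /=.
  by rewrite !modn_small; lia.
have mem_s (k k' : 'I_N) : (0 < k < h)%N -> (k + k')%N = N -> (k, k') \in s.
  move=> hk kk'; apply/mapP; exists (k : nat); first by rewrite mem_iota; lia.
  have lk := ltn_ord k; have lk' := ltn_ord k'.
  by congr (_, _); apply/val_inj => /=; rewrite modn_small; lia.
pose D : set (bR * bR) := [set z | z.1 ^+ 2 + z.2 ^+ 2 <= t2].
pose I1 : set bR := [set x | x ^+ 2 <= t1].
pose B i : set bR := if i == ordm 0 then if b then I1 else setT
                     else if i == ordm h then I1 else setT.
have mI1 : measurable I1 by rewrite /I1 sqr_le_itv.
have mB i : measurable (B i) by rewrite /B; case: ifP => _; case: ifP.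
have mD : measurable D by exact: measurable_disk.
have u1 : unzip1 s = [seq ordm k | k <- iota 1 (h - 1)].
  by rewrite /unzip1 -map_comp.
have u2 : unzip2 s = [seq ordm (N - k) | k <- iota 1 (h - 1)].
  by rewrite /unzip2 -map_comp.
have us : uniq (unzip1 s ++ unzip2 s).
  rewrite u1 u2 cat_uniq; apply/and3P; split.
  - rewrite map_inj_in_uniq ?iota_uniq// => x y; rewrite !mem_iota => hx hy.
    by move=> /(congr1 val)/=; rewrite !modn_small; lia.
  - apply/hasPn => _ /mapP[k + ->]; rewrite mem_iota => hk; apply/mapP => -[k'].
    by rewrite mem_iota => hk' /(congr1 val)/=; rewrite !modn_small; lia.
  - rewrite map_inj_in_uniq ?iota_uniq// => x y; rewrite !mem_iota => hx hy.
    by move=> /(congr1 val)/=; rewrite !modn_small; lia.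
have nJ k : k = 0%N \/ k = h -> ordm k \notin unzip1 s ++ unzip2 s.
  move=> hk; rewrite mem_cat negb_or u1 u2; apply/andP; split; apply/mapP => -[k'];
  by rewrite mem_iota => hk' /(congr1 val)/=; rewrite !modn_small; lia.
have h0 : ordm h != ordm 0.
  by apply/eqP => /(congr1 val)/=; rewrite !modn_small; lia.
have nJ0 := nJ 0%N (or_introl erefl); have nJh := nJ h (or_intror erefl).
have := @joint_law_pairs R d _ T bR P (normal_prob 0 sigma) _ Y jY
  s (fun=> D) B us (fun=> mD) mB.
rewrite (_ : [set w | _] = spectral_event Y b t1 t2).
  move=> ->.
  rewrite [X in (_ * X)%E](bigD1 (ordm 0))//=.
  rewrite [X in (_ * (_ * X))%E](bigD1 (ordm h)) ?nJh ?h0//=.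
  rewrite [X in (_ * (_ * (_ * X)))%E]big1; last first.
    move=> i /andP[/andP[_ i0] ih].
    by rewrite /B (negbTE i0) (negbTE ih) probability_setT.
  rewrite mule1 /B eqxx (negbTE h0) eqxx normal_prod_disk// prode_const.
  rewrite size_map size_iota.
  rewrite muleC EFinM; congr (_ * _)%E; rewrite -/B /I1 normal_prob_sqr_le//.
  case: b {B mB} => /=; last by rewrite probability_setT mul1e expr1.
  by rewrite normal_prob_sqr_le// -EFinM.
apply/seteqP; split => w /=.
  move=> [h1 h2]; split.
  - by move=> bt; have := h2 (ordm 0) nJ0; rewrite /B eqxx bt.
  - by have := h2 (ordm h) nJh; rewrite /B (negbTE h0) eqxx.
  - by move=> k k' hk kk'; exact: (h1 (k, k') (mem_s _ _ hk kk')).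
move=> [h1 h2 h3]; split; first by move=> q /sP[hq qN]; exact: h3.
move=> i _; rewrite /B; case: eqP => [->|_]; first by case: b h1 {B mB} => //; exact.
by case: eqP => [->|].
Qed.

Notation H g := (fun k w => \sum_n hartley R k n * (g : 'I_N -> T -> R) n w).

Lemma dft_power_spectral (g : 'I_N -> T -> R) w (k k' : 'I_N) :
  (k + k')%N = N \/ k = k' /\ (k = ordm 0 \/ k = ordm h) ->
  ComplexField.Normc.normc (dft (realvec (fun n => g n w)) k) ^+ 2 =
  (H g k w ^+ 2 + H g k' w ^+ 2) / (2 * N%:R).
Proof.
move=> kk; apply: dft_power_hartley => //; case: kk => [->//|[<- [] ->]] /=.
  by rewrite mod0n.
by rewrite modn_small; [rewrite -Nh | lia].
Qed.

Let N0 : 0 < N%:R :> R. Proof. by rewrite ltr0n. Qed.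

(** A self-paired bin has power [H ^+ 2 / N] and a pair has its sum of squares over [2 * N], hence
    the two thresholds. Bins above N/2 repeat the condition of their mirror image. *)
Lemma gain_event (g : 'I_N -> T -> R) (p : R) :
  [set w | forall k : 'I_N, (1 <= k)%N -> gain_power (fun n => g n w) k <= p] =
  spectral_event (H g) false (N%:R * p) (2 * N%:R * p).
Proof.
have N2 : 0 < 2 * N%:R :> R by rewrite mulr_gt0.
apply/seteqP; split => w.
  move=> hw; split=> //.
    have := hw (ordm h); rewrite ordmE; last by lia.
    move=> /(_ h_gt0); rewrite /gain_power (@dft_power_spectral _ _ _ (ordm h)).
      by rewrite ler_pdivrMr//; lra.
    by right; split=> //; right.
  move=> k k' hk kk; have := hw k.
  rewrite /gain_power (@dft_power_spectral _ _ _ k'); last by left.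
  by rewrite ler_pdivrMr// mulrC; apply; lia.
move=> [_ h1 h2] k k1; rewrite /gain_power.
have lk := ltn_ord k.
have kk : (k + ordm (N - k) = N)%N by rewrite ordmE; lia.
case: (ltngtP k h) => hk.
- rewrite (@dft_power_spectral _ _ _ (ordm (N - k))); last by left.
  by rewrite ler_pdivrMr// mulrC; apply: h2 => //; lia.
- rewrite (@dft_power_spectral _ _ _ (ordm (N - k))); last by left.
  by rewrite ler_pdivrMr// mulrC addrC; apply: h2; [rewrite ordmE; lia | lia].
- have -> : k = ordm h by apply/val_inj; rewrite /= modn_small; lia.
  rewrite (@dft_power_spectral _ _ _ (ordm h)); last by right; split=> //; right.
  rewrite ler_pdivrMr//; lra.
Qed.

(** The single-sided weights 2 and 4 exactly compensate the factor 2 between self-paired bins and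
    pairs, so both thresholds coincide. *)
Lemma offset_event (o : 'I_N -> T -> R) (p : R) :
  [set w | forall k : 'I_N, (k <= h)%N -> offset_power (fun n => o n w) k <= p] =
  spectral_event (H o) true (N%:R * p / 2) (N%:R * p / 2).
Proof.
have N2 : 0 < 2 * N%:R :> R by rewrite mulr_gt0.
have single w k : (k = 0%N \/ k = h) ->
    (offset_power (fun n => o n w) (ordm k) <= p) =
    (H o (ordm k) w ^+ 2 <= N%:R * p / 2).
  move=> hk; have lk : (k < N)%N by case: hk => ->; lia.
  rewrite /offset_power ordmE// -/h (_ : (k == 0)%N || (k == h)%N); last first.
    by case: hk => ->; rewrite eqxx ?orbT.
  rewrite (@dft_power_spectral _ _ _ (ordm k)); last first.
    by right; split => //; case: hk => ->; [left|right].
  by rewrite mulrA ler_pdivrMr//; apply/idP/idP => ?; lra.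
have pair w (k k' : 'I_N) : (0 < k < h)%N -> (k + k')%N = N ->
    offset_power (fun n => o n w) k =
    4 * ((H o k w ^+ 2 + H o k' w ^+ 2) / (2 * N%:R)).
  move=> hk kk; rewrite /offset_power -/h.
  rewrite (_ : (k == 0 :> nat)%N || (k == h :> nat)%N = false); last by lia.
  by rewrite (@dft_power_spectral _ _ _ k')//; left.
apply/seteqP; split => w.
  move=> hw; split=> [_||].
  - by rewrite -single; [apply: hw; rewrite ordmE|left].
  - by rewrite -single; [apply: hw; rewrite ordmE//; lia|right].
  - move=> k k' hk kk; have := hw k; rewrite (pair _ _ k')// => /(_ _).
    by rewrite mulrA ler_pdivrMr// => /(_ ltac:(lia)); lra.
move=> [h1 h2 h3] k kh; have lk := ltn_ord k.
have [k0|k0] := posnP k.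
  have -> : k = ordm 0 by apply/val_inj; rewrite /= modn_small.
  by rewrite single; [exact: h1|left].
have [ke|kne] := eqVneq (k : nat) h.
  have -> : k = ordm h by apply/val_inj; rewrite /= modn_small; lia.
  by rewrite single; [|right].
have kk : (k + ordm (N - k) = N)%N by rewrite ordmE; lia.
rewrite (pair _ _ (ordm (N - k)))//; last by lia.
have := h3 k _ _ kk; rewrite mulrA ler_pdivrMr// => /(_ ltac:(lia)); lra.
Qed.

End spectrum.

(** The condition [0 <= p] accounts for the default value 0 of the maximum. *)
Lemma bigmax_le_event (R : realType) (T : Type) (I : finType) (Q : pred I)
    (F : T -> I -> R) (p : R) : 0 <= p ->
  [set w | \big[Num.max/0]_(k | Q k) F w k <= p] =
  [set w | forall k, Q k -> F w k <= p].
Proof.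
move=> p0; apply/seteqP; split => w /=; first by move=> /bigmax_leP[].
by move=> Fp; apply/bigmax_leP.
Qed.

Unset Implicit Arguments.

Theorem mainTheorem8 (R : realType) (d : measure_display)
    (T : measurableType d) (P : probability T R)
    (N : nat) (N_ge2 : (2 <= N)%N) (N_even : ~~ odd N) :
  (forall (sigma : R) (o : 'I_N -> {RV P >-> R}),
      0 < sigma -> iid_centered_normal sigma o ->
      forall p : R, 0 <= p ->
        P [set w | \big[Num.max/0]_(k < N | (k <= N./2)%N)
                     offset_power (fun n => o n w) k <= p] =
        (erf (Num.sqrt (N%:R * p / (4 * sigma ^+ 2))) ^+ 2 *
         (1 - expR (- (N%:R * p / (4 * sigma ^+ 2)))) ^+ (N./2 - 1))%:E)
  /\
  (forall (sigma : R) (g : 'I_N -> {RV P >-> R}),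
      0 < sigma -> iid_centered_normal sigma g ->
      forall p : R, 0 <= p ->
        P [set w | \big[Num.max/0]_(k < N | (1 <= k)%N)
                     gain_power (fun n => g n w) k <= p] =
        (erf (Num.sqrt (N%:R * p / (2 * sigma ^+ 2))) *
         (1 - expR (- (N%:R * p / sigma ^+ 2))) ^+ (N./2 - 1))%:E)
  /\
  (forall (fsig sigma : R) (s : 'I_N -> {RV P >-> R}),
      0 < fsig -> 0 < sigma -> iid_centered_normal sigma s ->
      forall p : R, 0 <= p ->
        P [set w | \big[Num.max/0]_(k < N | (1 <= k)%N)
                     skew_power fsig (fun n => s n w) k <= p] =
        (erf (Num.sqrt (N%:R * p / (8 * pi ^+ 2 * fsig ^+ 2 * sigma ^+ 2))) *
         (1 - expR (- (N%:R * p / (4 * pi ^+ 2 * fsig ^+ 2 * sigma ^+ 2))))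
           ^+ (N./2 - 1))%:E).
Proof.
have N_gt0 : (0 < N)%N by exact: ltnW.
have hartley_law sigma (X : 'I_N -> {RV P >-> R}) : 0 < sigma ->
    iid_centered_normal sigma X ->
    joint_law P (normal_prob 0 sigma : probability (measurableTypeR R) R)
      (fun k w => \sum_n hartley R k n * X n w).
  move=> s0 iid; have := iid_joint_law iid.
  by apply: (joint_law_orthogonal s0); exact: hartley_orthonormal.
have gain (sigma : R) (g : 'I_N -> {RV P >-> R}) (p : R) :
    0 < sigma -> iid_centered_normal sigma g -> 0 <= p ->
    P [set w | forall k : 'I_N, (1 <= k)%N -> gain_power (fun n => g n w) k <= p] =
    (erf (Num.sqrt (N%:R * p / (2 * sigma ^+ 2))) *
         (1 - expR (- (N%:R * p / sigma ^+ 2))) ^+ (N./2 - 1))%:E.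
  move=> s0 iid p0; rewrite (gain_event N_ge2 N_even (fun n => g n)).
  rewrite (spectral_event_prob N_ge2 N_even _ s0 (hartley_law _ _ s0 iid)) ?mulr_ge0//.
  have -> : 2 * N%:R * p / (2 * sigma ^+ 2) = N%:R * p / sigma ^+ 2.
    by field; rewrite gt_eqF.
  by rewrite expr1.
split; [|split].
- move=> sigma o s0 iid p p0; rewrite bigmax_le_event//.
  rewrite (offset_event N_ge2 N_even (fun n => o n)).
  rewrite (spectral_event_prob N_ge2 N_even _ s0 (hartley_law _ _ s0 iid)) ?mulr_ge0//.
  have -> : N%:R * p / 2 / (2 * sigma ^+ 2) = N%:R * p / (4 * sigma ^+ 2).
    by field; rewrite gt_eqF.
  by [].
- by move=> sigma g s0 iid p p0; rewrite bigmax_le_event//; exact: gain.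
- move=> f sigma s f0 s0 iid p p0; rewrite bigmax_le_event//.
  have pi0 : 0 < (pi : R) by exact: pi_gt0.
  have c0 : 0 < (2 * pi * f) ^+ 2 by rewrite exprn_gt0// !mulr_gt0.
  (* The skew power is the gain power times a positive constant, so the gain formula applies at the
     rescaled threshold. *)
  rewrite (_ : [set w | _] = [set w | forall k : 'I_N, (1 <= k)%N ->
      gain_power (fun n => s n w) k <= p / (2 * pi * f) ^+ 2]).
    rewrite (gain _ _ _ s0 iid) ?divr_ge0 ?(ltW c0)//.
    move: (pi : R) pi0 {c0} => q q0.
    have -> : N%:R * (p / (2 * q * f) ^+ 2) / (2 * sigma ^+ 2) =
        N%:R * p / (8 * q ^+ 2 * f ^+ 2 * sigma ^+ 2).
      by field; rewrite !gt_eqF.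
    have -> : N%:R * (p / (2 * q * f) ^+ 2) / sigma ^+ 2 =
        N%:R * p / (4 * q ^+ 2 * f ^+ 2 * sigma ^+ 2).
      by field; rewrite !gt_eqF.
    by [].
  apply/seteqP; split => w /= hw k k1; have := hw k k1;
  by rewrite /skew_power /gain_power ler_pdivlMr// mulrC.
Qed.
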